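(* Let $n\ge1$, $R>0$, and let $K\subset\mathbb{R}^{n+1}=\mathbb{R}^n\times\mathbb{R}$ be the closed ball of radius $R$ centered at the origin. Let $G\colon\mathbb{R}^n\to\mathbb{R}$ be twice continuously differentiable with $|x|^2+G(x)^2>0$ for all $x$, and define $h\colon\mathbb{R}^n\to\mathbb{R}^n$ by $$h(x)=x-\frac{\sqrt{|x|^2+G(x)^2}-R}{\sqrt{|x|^2+G(x)^2}}\left(x+2\,\frac{G(x)-\langle x,\nabla G(x)\rangle}{1+|\nabla G(x)|^2}\,\nabla G(x)\right).$$ Suppose $h$ is a bijection from $\mathbb{R}^n$ onto an open set $J\subset\mathbb{R}^n$ containing $0$, with nowhere vanishing derivative (Jacobian). Then $G$ is an equidistant function (i.e. there is an admissible $f$ such that the equidistant set of $K$ and the epigraph of $f$ is the graph of $G$) if and only if the pair $x(t):=h^{-1}(t)$, $y(t):=G(x(t))$ ($t\in J$) is the equidistant parameterization for the graph of $G$, i.e. there is an admissible $f$ with $D_f=J$ and $x=x_f$, $y=y_f$ on $J$.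
   Context: $d(p,A)=\inf\{|p-q|\mid q\in A\}$ (Euclidean distance). A function $f\colon\mathbb{R}^n\to(0,\infty)$ is admissible if it is twice continuously differentiable, convex, and $|t|^2+f(t)^2>R^2$ for all $t$; its epigraph is $L_f=\{(t,y)\mid f(t)\le y\}$ and the equidistant set is $\{K=L_f\}=\{p\mid d(p,K)=d(p,L_f)\}$. For admissible $f$ put $\alpha_f(t)=\frac{\langle t,\nabla f(t)\rangle-f(t)}{\sqrt{1+|\nabla f(t)|^2}}$, $D_f=\{t\mid\alpha_f(t)<R\}$, and the equidistant parameterization $x_f\colon D_f\to\mathbb{R}^n$, $y_f\colon D_f\to\mathbb{R}$, $x_f(t)=t+\frac{1}{2\sqrt{1+|\nabla f(t)|^2}}\cdot\frac{|t|^2+f(t)^2-R^2}{R-\alpha_f(t)}\nabla f(t)$, $y_f(t)=f(t)-\frac{1}{2\sqrt{1+|\nabla f(t)|^2}}\cdot\frac{|t|^2+f(t)^2-R^2}{R-\alpha_f(t)}$. *)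

(* Defs.v *)
From HB Require Import structures.
From mathcomp Require Import all_boot all_order all_algebra.
From mathcomp Require Import all_classical all_reals all_analysis.
Set Implicit Arguments. Unset Strict Implicit. Unset Printing Implicit Defensive.
Import Order.TTheory GRing.Theory Num.Theory.
Import numFieldNormedType.Exports.
Local Open Scope ring_scope.
Local Open Scope classical_set_scope.

Section Defs.
Variables (R : realType) (n : nat).
Local Notation vec := 'rV[R]_n.

Definition dotp (u v : vec) : R := \sum_(i < n) u ord0 i * v ord0 i.
Definition sqn (u : vec) : R := dotp u u.

Definition unitv (i : 'I_n) : vec := delta_mx ord0 i.

Definition partial (f : vec -> R) (i : 'I_n) (x : vec) : R := derive f x (unitv i).

Definition C1 (f : vec -> R) : Prop :=
  forall i : 'I_n, (forall x, derivable f x (unitv i)) /\ continuous (partial f i).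
Definition C2 (f : vec -> R) : Prop := C1 f /\ forall i : 'I_n, C1 (partial f i).

Definition grad (f : vec -> R) (x : vec) : vec := \row_(i < n) partial f i x.

Definition jac (h : vec -> vec) (x : vec) : 'M[R]_n :=
  \matrix_(i < n, j < n) partial (fun y => h y ord0 i) j x.

Definition convexf (f : vec -> R) : Prop :=
  forall (x y : vec) (a : R), 0 <= a -> a <= 1 ->
    f (a *: x + (1 - a) *: y) <= a * f x + (1 - a) * f y.

Definition admissible (r : R) (f : vec -> R) : Prop :=
  C2 f /\ convexf f /\ (forall t, 0 < f t) /\
  (forall t, r ^+ 2 < sqn t + f t ^+ 2).

Definition pdist (p q : vec * R) : R :=
  Num.sqrt (sqn (p.1 - q.1) + (p.2 - q.2) ^+ 2).
Definition dset (p : vec * R) (A : set (vec * R)) : R :=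
  inf [set d | exists2 q, A q & d = pdist p q].

Definition ballK (r : R) : set (vec * R) := [set p | sqn p.1 + p.2 ^+ 2 <= r ^+ 2].
Definition epi (f : vec -> R) : set (vec * R) := [set p | f p.1 <= p.2].
Definition equidistant (A B : set (vec * R)) : set (vec * R) :=
  [set p | dset p A = dset p B].
Definition graph (G : vec -> R) : set (vec * R) := [set p | p.2 = G p.1].

Definition equidistant_function (r : R) (G : vec -> R) : Prop :=
  exists f, admissible r f /\ equidistant (ballK r) (epi f) = graph G.

Definition alpha (f : vec -> R) (t : vec) : R :=
  (dotp t (grad f t) - f t) / Num.sqrt (1 + sqn (grad f t)).
Definition Df (r : R) (f : vec -> R) : set vec := [set t | alpha f t < r].
Definition coefp (r : R) (f : vec -> R) (t : vec) : R :=
  (2 * Num.sqrt (1 + sqn (grad f t)))^-1 *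
  ((sqn t + f t ^+ 2 - r ^+ 2) / (r - alpha f t)).
Definition xf (r : R) (f : vec -> R) (t : vec) : vec := t + coefp r f t *: grad f t.
Definition yf (r : R) (f : vec -> R) (t : vec) : R := f t - coefp r f t.

Definition hmap (r : R) (G : vec -> R) (x : vec) : vec :=
  let s := Num.sqrt (sqn x + G x ^+ 2) in
  x - ((s - r) / s) *:
      (x + (2 * ((G x - dotp x (grad G x)) / (1 + sqn (grad G x)))) *: grad G x).

End Defs.

(* Main.v *)
(** For admissible f, a point p is equidistant exactly when the ball around p
    touching the epigraph L, say at (t, f t), has radius d = |p| - r. The touching
    condition forces p = (t, f t) + c (grad f t, -1) with c > 0, and |p| = d + r
    is then a linear equation for c, solvable iff alpha f t < r, with solution
    the coefficient of the equidistant parameterization. Hence the equidistant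
    set is the image of (xf, yf) over Df.

    If this set is the graph of G, its normal at p bisects the directions from
    the origin and from (t, f t) to p, so the foot (t, f t) is obtained from p
    by a reflection depending only on grad G: this says hmap (xf t) = t. As
    hmap is a bijection onto J, Df = J and xf is its inverse. *)
Require Import Defs.
From HB Require Import structures.
From mathcomp Require Import all_boot all_order all_algebra.
From mathcomp Require Import all_classical all_reals all_analysis.
From mathcomp Require Import ring lra.
Import Order.TTheory GRing.Theory Num.Theory.
Import numFieldNormedType.Exports.
Local Open Scope ring_scope.
Local Open Scope classical_set_scope.

(** * Algebra of the dot product and the squared norm *)

Section DotProduct.
Context {R : realType} {n : nat}.
Implicit Types u v w : 'rV[R]_n.

Lemma dotpC u v : dotp u v = dotp v u.
Proof. by apply: eq_bigr => i _; rewrite mulrC. Qed.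

Lemma dotpDl u v w : dotp (u + v) w = dotp u w + dotp v w.
Proof. by rewrite -big_split; apply: eq_bigr => i _; rewrite mxE mulrDl. Qed.

Lemma dotpZl a u w : dotp (a *: u) w = a * dotp u w.
Proof. by rewrite /dotp big_distrr; apply: eq_bigr => i _; rewrite mxE -mulrA. Qed.

Lemma dotpNl u w : dotp (- u) w = - dotp u w.
Proof. by rewrite -scaleN1r dotpZl mulN1r. Qed.

Lemma dotpDr u v w : dotp w (u + v) = dotp w u + dotp w v.
Proof. by rewrite dotpC dotpDl !(dotpC w). Qed.

Lemma dotpZr a u w : dotp w (a *: u) = a * dotp w u.
Proof. by rewrite dotpC dotpZl dotpC. Qed.

Lemma dotpNr u w : dotp w (- u) = - dotp w u.
Proof. by rewrite dotpC dotpNl dotpC. Qed.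

Lemma dotp_unitvr u i : dotp u (unitv R i) = u ord0 i.
Proof.
rewrite /dotp (bigD1 i)//= big1 ?addr0 => [|j ji]; rewrite !mxE/=.
  by rewrite !eqxx mulr1.
by rewrite (negbTE ji) mulr0.
Qed.

Lemma sqn_ge0 u : 0 <= sqn u.
Proof. by apply: sumr_ge0 => i _; rewrite -expr2 sqr_ge0. Qed.

Lemma sqnD u v : sqn (u + v) = sqn u + 2 * dotp u v + sqn v.
Proof. by rewrite /sqn !(dotpDl, dotpDr) (dotpC v u); ring. Qed.

Lemma sqnN u : sqn (- u) = sqn u.
Proof. by rewrite /sqn dotpNl dotpNr opprK. Qed.

Lemma sqnB u v : sqn (u - v) = sqn u - 2 * dotp u v + sqn v.
Proof. by rewrite sqnD dotpNr sqnN; ring. Qed.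

Lemma sqnZ a u : sqn (a *: u) = a ^+ 2 * sqn u.
Proof. by rewrite /sqn dotpZl dotpZr; ring. Qed.

Lemma sqr_coord_le_sqn u i : u ord0 i ^+ 2 <= sqn u.
Proof.
rewrite /sqn /dotp (bigD1 i)//= expr2 lerDl.
by apply: sumr_ge0 => j _; rewrite -expr2 sqr_ge0.
Qed.

Lemma sqn_eq0 u : sqn u = 0 -> u = 0.
Proof.
move=> u0; apply/rowP => i; rewrite mxE; apply/eqP; rewrite -sqrf_eq0 eq_le sqr_ge0.
by rewrite -u0 sqr_coord_le_sqn.
Qed.

Lemma sqrt1sqn_gt0 u : 0 < Num.sqrt (1 + sqn u).
Proof. by rewrite sqrtr_gt0 ltr_wpDr ?sqn_ge0. Qed.

Lemma cvg_dotp {T : Type} (F : set_system T) {FF : Filter F}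
    (f g : T -> 'rV[R]_n) u v :
  (forall i, f x ord0 i @[x --> F] --> u ord0 i) ->
  (forall i, g x ord0 i @[x --> F] --> v ord0 i) ->
  dotp (f x) (g x) @[x --> F] --> dotp u v.
Proof.
move=> fu gv; rewrite /dotp; elim: (index_enum _) => [|i s IHs].
  by under eq_fun do rewrite big_nil; rewrite big_nil; exact: cvg_cst.
under eq_fun do rewrite big_cons; rewrite big_cons.
by apply: cvgD IHs; exact: cvgM.
Qed.

End DotProduct.

(** * Directional derivatives and Fermat's rule *)

Section Calculus.
Context {R : realType}.

Lemma derivable_approx {V : normedModType R} (f : V -> R) (x v : V) :
  derivable f x v -> forall e : R, 0 < e ->
  exists2 d : R, 0 < d & forall h : R, `|h| < d ->
    `|f (h *: v + x) - f x - h * 'D_v f x| <= e * `|h|.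
Proof.
move=> df e e0; have /cvgrPdist_le /(_ _ e0) :
    h^-1 *: ((f \o shift x) (h *: v) - f x) @[h --> 0^'] --> 'D_v f x.
  exact: df.
move=> [d /= d0 H]; exists d => // h hd.
have [->|h0] := eqVneq h 0.
  by rewrite scale0r add0r subrr mul0r subrr normr0 mulr0.
have /= := H h; rewrite sub0r normrN => /(_ hd h0) {}H.
rewrite -ler_pdivrMr ?normr_gt0// -normfV -normrM.
rewrite distrC in H; apply: le_trans H.
rewrite le_eqVlt; apply/orP; left; apply/eqP; congr `| _ |.
by rewrite /shift/= [_ *: _ : R]mulrC; field.
Qed.

Lemma derive_min {V : normedModType R} (f : V -> R) (x v : V) :
  derivable f x v -> (forall y, f x <= f y) -> 'D_v f x = 0.
Proof.
move=> df fmin; apply: contrapT => /eqP D0.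
have e0 : 0 < `|'D_v f x| / 2 by rewrite divr_gt0 ?normr_gt0.
have [d d0 H] := derivable_approx f x v df _ e0.
(* A step against the sign of the derivative, with error at most half of the first-order term, would
   bring [f] below its minimum. *)
pose h := - Num.sg ('D_v f x) * (d / 2).
have nh : `|h| = d / 2.
  by rewrite /h normrM normrN normr_sg D0 mul1r gtr0_norm// divr_gt0.
have := H h; rewrite nh => /(_ ltac:(lra)).
rewrite ler_distl => /andP[_]; rewrite leNgt => /negP; apply.
rewrite /h !mulNr mulrAC -normrEsg.
have := fmin (h *: v + x); have : 0 < `|'D_v f x| by rewrite normr_gt0.
rewrite /h !mulNr; nra.
Qed.

End Calculus.

(** * Stationarity along graphs, and supporting hyperplanes of convex functions *)

Section Gradient.
Context {R : realType} {n : nat}.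
Implicit Types (f : 'rV[R]_n -> R) (s t u v x : 'rV[R]_n).

(* First-order condition for a minimum of a |P|^2 - 2 <P, (t, z)> over P in the
   graph of f. *)
Lemma grad_graph_min f x t (a z : R) :
  (forall i, derivable f x (unitv R i)) ->
  (forall s, a * (sqn x + f x ^+ 2) - 2 * (dotp x t + f x * z) <=
             a * (sqn s + f s ^+ 2) - 2 * (dotp s t + f s * z)) ->
  a *: x - t = (z - a * f x) *: grad f x.
Proof.
move=> df fmin; apply/rowP => i; rewrite !mxE /partial.
set D := 'D_(unitv R i) f x.
pose g (h : R) : R := f (h *: unitv R i + x).
have dg : is_derive (0 : R) (1 : R) g D.
  have quot : (fun h : R => h^-1 *: ((g \o shift 0) (h *: 1) - g 0)) =
              (fun h : R => h^-1 *: ((f \o shift x) (h *: unitv R i) - f x)).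
    by apply: funext => h; rewrite /g /= addr0 scale0r add0r [h *: 1]mulr1.
  by apply: DeriveDef; rewrite /derivable /derive quot //; exact: df.
(* The objective along the [i]-th coordinate line through [x], built from function operations so
   that the differentiation rules apply. *)
pose F : R -> R := a *: (cst (sqn x) + (2 * x ord0 i) *: id + id * id + g * g)
   - (2 : R) *: (cst (dotp x t) + t ord0 i *: id + z *: g).
have FE h : F h = a * (sqn (h *: unitv R i + x) + f (h *: unitv R i + x) ^+ 2)
   - 2 * (dotp (h *: unitv R i + x) t + f (h *: unitv R i + x) * z).
  rewrite sqnD sqnZ dotpZl dotpDl dotpZl ![dotp (unitv R i) _]dotpC /sqn !dotp_unitvr.
  have -> : F h = a * (sqn x + 2 * x ord0 i * h + h * h + g h * g h)
                - 2 * (dotp x t + t ord0 i * h + z * g h) by [].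
  by rewrite /g -/(sqn x) [unitv R i _ _]mxE !eqxx/=; ring.
have dF : is_derive (0 : R) (1 : R) F
    (2 * (a * x ord0 i - t ord0 i + (a * f x - z) * D)).
  have did := @is_derive_id R R 0 1.
  have dcst b := @is_derive_cst R R R b 0 1.
  have dA := is_deriveD (is_deriveD (is_deriveD (dcst (sqn x))
    (is_deriveZ (2 * x ord0 i) did)) (is_deriveM did did)) (is_deriveM dg dg).
  have dB := is_deriveD (is_deriveD (dcst (dotp x t))
    (is_deriveZ (t ord0 i) did)) (is_deriveZ z dg).
  apply: (is_derive_eq (is_deriveB (is_deriveZ a dA) (is_deriveZ 2 dB))).
  have g0 : g 0 = f x by rewrite /g scale0r add0r.
  by rewrite g0 /GRing.scale /=; ring.
have := derive_min F 0 1 ex_derive; rewrite derive_val => F'0.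
suff : forall h, F 0 <= F h by move=> /F'0; lra.
by move=> h; rewrite !FE scale0r add0r.
Qed.

Lemma convex_support f t s : convexf f ->
  (forall i, derivable f t (unitv R i)) ->
  f t + dotp (grad f t) (s - t) <= f s.
Proof.
move=> fconv df.
(* Convexity makes this class of directions closed under addition, so that the
   partial derivatives control every direction. *)
pose small v := forall e : R, 0 < e -> exists2 d : R, 0 < d &
  forall h : R, `|h| < d ->
  f (h *: v + t) - f t - h * dotp (grad f t) v <= e * `|h|.
have smallZ c i : small (c *: unitv R i).
  (* Dividing by [|c| + 1] instead of [|c|] covers [c = 0]. *)
  move=> e e0; have c1 : 0 < `|c| + 1 by rewrite ltr_wpDl.
  have [d d0 H] := derivable_approx f t _ (df i) _ (divr_gt0 e0 c1).
  exists (d / (`|c| + 1)); first exact: divr_gt0.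
  move=> h; rewrite ltr_pdivlMr// => hd.
  have hc : `|h * c| < d.
    by apply: le_lt_trans hd; rewrite normrM ler_wpM2l// lerDl.
  have /ler_normlP[_] := H _ hc.
  rewrite scalerA dotpZr dotp_unitvr mxE mulrA => /le_trans; apply.
  rewrite mulrAC ler_pdivrMr// normrM -!mulrA ler_wpM2l ?(ltW e0)//.
  by rewrite ler_wpM2l// lerDl.
have smallD u v : small u -> small v -> small (u + v).
  move=> su sv e e0; have e2 : 0 < e / 2 by rewrite divr_gt0.
  have [d d0 Hd] := su _ e2; have [d' d'0 Hd'] := sv _ e2.
  (* The radius is halved because [h (u + v) + t] is the midpoint of [2 h u + t] and [2 h v + t]. *)
  exists (Num.min d d' / 2); first by rewrite divr_gt0// lt_min d0.
  move=> h; rewrite ltr_pdivlMr// mulrC lt_min => /andP[hd hd'].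
  have n2h : `|2 * h| = 2 * `|h| by rewrite normrM gtr0_norm.
  have := Hd (2 * h); rewrite n2h => /(_ hd).
  have := Hd' (2 * h); rewrite n2h => /(_ hd').
  have := fconv ((2 * h) *: u + t) ((2 * h) *: v + t) (2^-1).
  have -> : 2^-1 *: ((2 * h) *: u + t) + (1 - 2^-1) *: ((2 * h) *: v + t) =
            h *: (u + v) + t.
    by apply/rowP => i; rewrite !mxE; field.
  move=> /(_ ltac:(lra) ltac:(lra)); rewrite dotpDr; lra.
have smallT v : small v.
  have -> : v = \sum_i v ord0 i *: unitv R i by rewrite [LHS]row_sum_delta.
  elim/big_ind : _ => // e e0; exists 1 => // h _.
  rewrite scaler0 add0r subrr sub0r dotpC /dotp big1 => [|i _].
    by rewrite mulr0 oppr0 mulr_ge0 ?(ltW e0).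
  by rewrite mxE mul0r.
set w := s - t.
have H e : 0 < e -> dotp (grad f t) w - (f s - f t) <= e.
  move=> e0; have [d d0 Hd] := smallT (- w) _ e0.
  pose h := d / 2; have h0 : 0 < h by rewrite divr_gt0.
  have := Hd h; rewrite gtr0_norm// => /(_ ltac:(rewrite /h; lra)).
  have k0 : 0 < (1 + h)^-1 by rewrite invr_gt0; lra.
  have kh : h * (1 + h)^-1 = 1 - (1 + h)^-1 by field; lra.
  (* [t] is the convex combination of [s] and [t - h w] with weights [h / (1 + h)] and
     [1 / (1 + h)], so the upper bound at [t - h w] becomes a lower bound for [f s]. *)
  have := fconv s (h *: - w + t) (h * (1 + h)^-1).
  have -> : (h * (1 + h)^-1) *: s + (1 - h * (1 + h)^-1) *: (h *: - w + t) = t.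
    by apply/rowP => i; rewrite /w !mxE; field; lra.
  have := ltW h0; move: (f t) (f s) (f (_ + t)) => A B C.
  rewrite dotpNr; move: (dotp _ _) => P h0' /(_ ltac:(nra) ltac:(nra)) E1 E2.
  have : (1 + h) * A <= h * B + C.
    have -> : h * B + C = (1 + h) * (h * (1 + h)^-1 * B + (1 - h * (1 + h)^-1) * C).
      by field; lra.
    by rewrite ler_wpM2l//; lra.
  nra.
suff /ler_addgt0Pl : forall e, 0 < e -> dotp (grad f t) w <= e + (f s - f t) by lra.
by move=> e /H; lra.
Qed.

End Gradient.

(** * Continuity of convex functions and nearest points of the epigraph *)

Section Epigraph.
Context {R : realType} {n : nat}.
Implicit Types (f : 'rV[R]_n -> R) (s t x : 'rV[R]_n) (p q : 'rV[R]_n * R).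

(** [C1] only speaks of partial derivatives. The support inequalities at [t] and at [s] squeeze
    [f s] between two expressions that tend to [f t]. *)
Lemma convex_C1_continuous f : convexf f -> C1 f -> continuous f.
Proof.
move=> fconv C1f t.
have df s i : derivable f s (unitv R i) by have [+ _] := C1f i; exact.
apply: (@squeeze_cvgr _ (nbhs t) _ _
    (fun s => f t + dotp (grad f t) (s - t))
    (fun s => f t + dotp (grad f s) (s - t))).
- near=> s; rewrite convex_support//=.
  by have := convex_support f s t fconv (df s); rewrite -(opprB s t) dotpNr; lra.
- rewrite -[X in _ --> X]addr0; apply: cvgD; first exact: cvg_cst.
  have -> : 0 = dotp (grad f t) (t - t) :> R.
    by rewrite subrr dotpC /dotp big1// => i _; rewrite mxE mul0r.
  apply: cvg_dotp => i; first exact: cvg_cst.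
  under eq_fun do rewrite !mxE; rewrite !mxE; apply: cvgB; last exact: cvg_cst.
  exact: coord_continuous.
- rewrite -[X in _ --> X]addr0; apply: cvgD; first exact: cvg_cst.
  have -> : 0 = dotp (grad f t) (t - t) :> R.
    by rewrite subrr dotpC /dotp big1// => i _; rewrite mxE mul0r.
  apply: cvg_dotp => i.
    by under eq_fun do rewrite mxE; rewrite mxE; have [_] := C1f i; exact.
  under eq_fun do rewrite !mxE; rewrite !mxE; apply: cvgB; last exact: cvg_cst.
  exact: coord_continuous.
Unshelve. all: by end_near. Qed.

Definition sqdist p q : R := sqn (p.1 - q.1) + (p.2 - q.2) ^+ 2.

Lemma sqdist_ge0 p q : 0 <= sqdist p q.
Proof. by rewrite addr_ge0 ?sqn_ge0 ?sqr_ge0. Qed.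

Lemma ler_pdist p q p' q' :
  (pdist p q <= pdist p' q') = (sqdist p q <= sqdist p' q').
Proof. by rewrite ler_sqrt// sqdist_ge0. Qed.

Lemma dset_min p q (A : set ('rV[R]_n * R)) : A q ->
  (forall q', A q' -> sqdist p q <= sqdist p q') -> dset p A = pdist p q.
Proof.
move=> Aq qmin; apply/eqP; rewrite eq_le; apply/andP; split.
  apply: ge_inf; last by exists q.
  by exists 0 => _ [q' _ ->]; exact: sqrtr_ge0.
apply: lb_le_inf; first by exists (pdist p q), q.
by move=> _ [q' /qmin qq' ->]; rewrite ler_pdist.
Qed.

(** Over a fixed [s] the best height is [max (f s) y], which leaves a continuous function [phi] of
    [s] to minimize; a compact box suffices for that. *)
Lemma epi_proj f p : continuous f ->
  exists2 q, epi f q & forall q', epi f q' -> sqdist p q <= sqdist p q'.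
Proof.
case: p => x y fcont.
pose phi s := sqdist (x, y) (s, Num.max (f s) y).
have phi_cont : continuous phi.
  move=> s.
  have c1 : sqn (x - s') @[s' --> s] --> sqn (x - s).
    by apply: (cvg_dotp (nbhs s)) => i; (under eq_fun do rewrite !mxE); rewrite !mxE;
      apply: cvgB; by [exact: cvg_cst | exact: coord_continuous].
  have cy : y @[_ --> s] --> y := @cvg_cst R y _ (nbhs s) (nbhs_filter s).
  have c2 : y - Num.max (f s') y @[s' --> s] --> y - Num.max (f s) y.
    have c3 : Num.max (f s') y @[s' --> s] --> Num.max (f s) y.
      under eq_fun do rewrite maxr_absE; rewrite maxr_absE.
      have ch := @cvg_cst R 2^-1 _ (nbhs s) (nbhs_filter s).
      have fs : f s' @[s' --> s] --> f s := fcont s.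
      exact: (cvgM (cvgD (cvgD fs cy) (cvg_norm (cvgB fs cy))) ch).
    exact: (cvgB cy c3).
  exact: (cvgD c1 (cvgM c2 c2)).
have phiP q : epi f q -> phi q.1 <= sqdist (x, y) q.
  case: q => s z; rewrite /epi/= => fsz; rewrite lerD2l/= -sqrrN -[leRHS]sqrrN.
  rewrite !opprB; case: (leP (f s) y) => fsy; last by rewrite ler_pXn2r// ?nnegrE; lra.
  by rewrite subrr expr0n sqr_ge0.
(* Outside the box of half-width [M] around [x], a single coordinate contributes more than
   [M ^ 2 >= M > phi x]. *)
pose M := 1 + phi x.
have phi0 s : 0 <= phi s by exact: sqdist_ge0.
pose B := [set s : 'rV[R]_n | forall i, `[x ord0 i - M, x ord0 i + M] (s ord0 i)].
have Bx : B x by move=> i /=; rewrite in_itv/=; have := phi0 x; rewrite /M; lra.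
have [c _ cmin] : exists2 c, c \in B & forall s, s \in B -> phi c <= phi s.
  apply: EVT_min_rV; first by exists x.
    have cB := @rV_compact R n (fun i => `[x ord0 i - M, x ord0 i + M]%classic).
    by apply: cB => i; exact: segment_compact.
  exact: continuous_subspaceT.
have cminT s : phi c <= phi s.
  have [Bs|] := pselect (B s); first by apply: cmin; rewrite inE.
  move=> /existsNP[i /=]; rewrite in_itv/= => /negP Hi.
  have cx : phi c <= phi x by apply: cmin; rewrite inE.
  apply: (le_trans cx); have := sqr_coord_le_sqn (x - s) i.
  rewrite /phi/sqdist/= -/(phi x) !mxE.
  have := sqr_ge0 (y - Num.max (f s) y); have := phi0 x.
  rewrite -/(sqdist (x, y) (x, Num.max (f x) y)) -/(phi x).
  move: Hi; rewrite negb_and -!ltNge /M => /orP[]; nra.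
exists (c, Num.max (f c) y); first by rewrite /epi/= le_max lexx.
by move=> q' /phiP; exact: le_trans.
Qed.

End Epigraph.

(** * The equidistant set of the ball and the epigraph *)

Section Equidistant.
Context {R : realType} {n : nat}.
Implicit Types (f G : 'rV[R]_n -> R) (s t x : 'rV[R]_n) (p q : 'rV[R]_n * R) (r c : R).

Lemma sqdistE p q : sqdist p q =
  sqn p.1 + p.2 ^+ 2 - 2 * (dotp p.1 q.1 + p.2 * q.2) + (sqn q.1 + q.2 ^+ 2).
Proof. by rewrite /sqdist sqnB; ring. Qed.

Lemma dset_mem p (A : set ('rV[R]_n * R)) : A p -> dset p A = 0.
Proof.
have pp : sqdist p p = 0 by rewrite sqdistE /sqn; ring.
move=> Ap; rewrite (dset_min p p)//; first by rewrite /pdist -/(sqdist p p) pp sqrtr0.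
by move=> q _; rewrite pp sqdist_ge0.
Qed.

Lemma dset_ball r p : 0 < r -> r ^+ 2 <= sqn p.1 + p.2 ^+ 2 ->
  dset p (ballK r) = Num.sqrt (sqn p.1 + p.2 ^+ 2) - r.
Proof.
case: p => x y /= r0 rp; set s := Num.sqrt _.
have rs : r <= s by rewrite -(ger0_norm (ltW r0)) -sqrtr_sqr ler_wsqrtr.
have s0 : 0 < s := lt_le_trans r0 rs.
have s2 : sqn x + y ^+ 2 = s ^+ 2.
  by rewrite sqr_sqrtr// addr_ge0 ?sqn_ge0 ?sqr_ge0.
have sq : sqdist (x, y) ((r / s) *: x, r / s * y) = (s - r) ^+ 2.
  rewrite sqdistE/= sqnZ dotpZr -/(sqn x).
  have -> : sqn x = s ^+ 2 - y ^+ 2 by rewrite -s2; ring.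
  by field; rewrite gt_eqF.
rewrite (dset_min _ ((r / s) *: x, r / s * y)).
- by rewrite /pdist -/(sqdist _ _) sq sqrtr_sqr ger0_norm// subr_ge0.
- by rewrite /ballK/= sqnZ [(_ * y) ^+ 2]exprMn -mulrDr s2 -exprMn divfK ?gt_eqF//.
move=> [u v]; rewrite /ballK/= => quv; rewrite sq sqdistE/= s2.
(* Cauchy-Schwarz in disguise: the squared distance from the radial point to [(u, v)] is
   nonnegative, which bounds their inner product. *)
have := sqdist_ge0 ((r / s) *: x, r / s * y) (u, v).
rewrite sqdistE/= sqnZ dotpZl [(_ * y) ^+ 2]exprMn -mulrDr s2 -exprMn divfK ?gt_eqF//.
move: (sqn u + v ^+ 2) quv => Q quv.
have -> : r / s * dotp x u + r / s * y * v = r / s * (dotp x u + y * v) by ring.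
move: (dotp x u + y * v) => P.
have -> : 2 * (r / s * P) = (r * (2 * P)) / s by ring.
rewrite addrAC subr_ge0 ler_pdivrMr// => H.
suff : r * (2 * P) <= r * (s ^+ 2 + Q - (s - r) ^+ 2) by rewrite ler_pM2l//; lra.
nra.
Qed.

(** The point lies on the downward normal at [(t, f t)], and the supporting hyperplane there keeps
    the epigraph on its other side. *)
Lemma foot_min f t c q : convexf f -> C1 f -> 0 <= c -> epi f q ->
  sqdist (t + c *: grad f t, f t - c) (t, f t) <=
  sqdist (t + c *: grad f t, f t - c) q.
Proof.
case: q => s z fconv C1f c0; rewrite /epi/= => fsz.
have := convex_support f t s fconv (fun i => proj1 (C1f i) t).
rewrite /sqdist/= (_ : t + c *: grad f t - t = c *: grad f t); last first.
  by rewrite addrAC subrr add0r.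
rewrite (_ : t + c *: grad f t - s = c *: grad f t - (s - t)); last first.
  by apply/rowP => i; rewrite !mxE; ring.
rewrite (sqnB (c *: _)) dotpZl; have := sqn_ge0 (s - t).
move: (dotp _ _) (sqn (s - t)) (sqn _) => P A B A0 H.
have := sqr_ge0 (z - f t); have : c * P <= c * (z - f t) by rewrite ler_wpM2l//; lra.
nra.
Qed.

Lemma sqdist_foot f t c :
  sqdist (t + c *: grad f t, f t - c) (t, f t) =
  (c * Num.sqrt (1 + sqn (grad f t))) ^+ 2.
Proof.
rewrite exprMn sqr_sqrtr ?addr_ge0 ?sqn_ge0// /sqdist/=.
by rewrite addrAC subrr add0r sqnZ; ring.
Qed.

Lemma dset_epi f t c : convexf f -> C1 f -> 0 <= c ->
  dset (t + c *: grad f t, f t - c) (epi f) =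
  c * Num.sqrt (1 + sqn (grad f t)).
Proof.
move=> fconv C1f c0; rewrite (dset_min _ (t, f t)).
- rewrite /pdist -/(sqdist _ _) sqdist_foot sqrtr_sqr ger0_norm//.
  by rewrite mulr_ge0 ?sqrtr_ge0.
- by rewrite /epi/=.
- by move=> q; exact: foot_min.
Qed.

(** At the nearest point of the epigraph, stationarity of the distance along the graph puts [(x, y)]
    on the normal. *)
Lemma epi_foot f x y : convexf f -> C1 f -> y < f x ->
  exists t c, [/\ 0 < c, x = t + c *: grad f t & y = f t - c].
Proof.
move=> fconv C1f yfx.
have [[t z]] := epi_proj f (x, y) (convex_C1_continuous _ fconv C1f).
rewrite /epi/= => ftz qmin.
have yft : y <= f t.
  rewrite leNgt; apply/negP => fty.
  (* The chord from [(t, f t)] to [(x, f x)] has height [y] at weight [a]; its point there belongs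
     to the epigraph and is closer to [(x, y)] unless [x = t]. *)
  pose a := (y - f t) / (f x - f t).
  have a0 : 0 < a by rewrite divr_gt0; lra.
  have a1 : a < 1 by rewrite ltr_pdivrMr; lra.
  have fa : f (a *: x + (1 - a) *: t) <= y.
    apply: le_trans (fconv _ _ _ (ltW a0) (ltW a1)) _.
    by rewrite le_eqVlt; apply/orP; left; apply/eqP; rewrite /a; field; lra.
  have := qmin (_, y) fa; rewrite /sqdist/=.
  rewrite (_ : x - (a *: x + (1 - a) *: t) = (1 - a) *: (x - t)); last first.
    by apply/rowP => i; rewrite !mxE; ring.
  rewrite sqnZ => H.
  have : sqn (x - t) = 0.
    have := sqn_ge0 (x - t); have := sqr_ge0 (y - z); move: H.
    move: (sqn _) => A; rewrite subrr expr0n/= addr0 => H Z A0.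
    apply: le_anti; rewrite A0 andbT leNgt; apply/negP => A0'.
    have : 0 < a * (2 - a) * A by apply: mulr_gt0 => //; apply: mulr_gt0 => //; lra.
    nra.
  by move=> /sqn_eq0 /subr0_eq xt; move: yfx fty; rewrite xt; lra.
have gmin s : sqdist (x, y) (t, f t) <= sqdist (x, y) (s, f s).
  apply: le_trans (qmin (s, f s) (lexx _)); rewrite /sqdist/= lerD2l; nra.
have := @grad_graph_min _ _ f t x 1 y (fun i => proj1 (C1f i) t).
rewrite scale1r [1 * f t]mul1r => H.
have xE : x = t + (f t - y) *: grad f t.
  rewrite -[f t - y]opprB scaleNr -H ?opprB ?subrKC// => s.
  by have := gmin s; rewrite !sqdistE/= (dotpC x t) (dotpC x s); lra.
exists t, (f t - y); split => //; last by rewrite opprB subrKC.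
rewrite subr_gt0 lt_neqAle yft andbT; apply/eqP => yE.
by move: yfx; rewrite xE yE subrr scale0r addr0 ltxx.
Qed.

(** Arranged around [(c * w + r) ^+ 2], so that the equation |p| = d + r loses its quadratic terms
    and becomes linear in [c]. *)
Lemma sqnorm_foot f t c r :
  let w := Num.sqrt (1 + sqn (grad f t)) in
  sqn (t + c *: grad f t) + (f t - c) ^+ 2 =
  (c * w + r) ^+ 2 + (sqn t + f t ^+ 2 - r ^+ 2) - 2 * c * w * (r - alpha f t).
Proof.
move=> w; have w0 : 0 < w := sqrt1sqn_gt0 _.
have w2 : w ^+ 2 = 1 + sqn (grad f t) by rewrite sqr_sqrtr ?addr_ge0 ?sqn_ge0.
rewrite sqnD sqnZ dotpZr /alpha -/w.
have -> : sqn (grad f t) = w ^+ 2 - 1 by rewrite w2; ring.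
by field; rewrite gt_eqF.
Qed.

Lemma coefp_gt0 r f t : admissible r f -> alpha f t < r -> 0 < Defs.coefp r f t.
Proof.
move=> [_ [_ [_ rf]]] ar; have := rf t; have := sqrt1sqn_gt0 (grad f t) => w0 rt.
by apply: mulr_gt0; [rewrite invr_gt0 mulr_gt0 | apply: divr_gt0; rewrite subr_gt0].
Qed.

Lemma sqnorm_xf_yf r f t : alpha f t < r ->
  sqn (xf r f t) + yf r f t ^+ 2 =
  (Defs.coefp r f t * Num.sqrt (1 + sqn (grad f t)) + r) ^+ 2.
Proof.
move=> ar; rewrite (sqnorm_foot _ _ _ r) -/(Defs.coefp r f t) /Defs.coefp.
have := sqrt1sqn_gt0 (grad f t); set w := Num.sqrt _ => w0.
by field; rewrite !gt_eqF ?subr_gt0.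
Qed.

Lemma equidistantP r f p : 0 < r -> admissible r f ->
  equidistant (ballK r) (epi f) p <->
  exists2 t, alpha f t < r & p = (xf r f t, yf r f t).
Proof.
move=> r0 adm; have [[C1f _] [fconv [f0 rf]]] := adm.
split; last first.
  move=> [t ar ->]; have c0 := coefp_gt0 _ _ _ adm ar.
  have w0 := sqrt1sqn_gt0 (grad f t).
  have cw0 : 0 < Defs.coefp r f t * Num.sqrt (1 + sqn (grad f t)) by rewrite mulr_gt0.
  rewrite /equidistant/= dset_ball//= sqnorm_xf_yf//; last by nra.
  rewrite sqrtr_sqr gtr0_norm ?addr_gt0// addrK.
  by rewrite dset_epi ?(ltW c0).
case: p => x y; rewrite /equidistant/= => xyeq.
(* A point of the epigraph has distance 0 to it but, as [f] is positive and its graph avoids the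
   ball, a positive distance to the ball. *)
have yfx : y < f x.
  rewrite ltNge; apply/negP => fxy.
  have rxy : r ^+ 2 < sqn x + y ^+ 2.
    apply: lt_le_trans (rf x) _; rewrite lerD2l ler_pXn2r// nnegrE ltW//.
    exact: lt_le_trans (f0 x) fxy.
  move: xyeq; rewrite dset_ball ?(ltW rxy)// [RHS]dset_mem//.
  move=> /subr0_eq sr; move: rxy; rewrite -sr sqr_sqrtr ?ltxx//.
  by rewrite addr_ge0 ?sqn_ge0 ?sqr_ge0.
have [t [c [c0 xE yE]]] := epi_foot _ _ _ fconv C1f yfx.
move: xyeq; rewrite xE yE dset_epi ?(ltW c0)//.
have := sqrt1sqn_gt0 (grad f t); set w := Num.sqrt _ => w0.
have cw0 : 0 < c * w by rewrite mulr_gt0.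
have [xyr|xyr] := leP (sqn x + y ^+ 2) (r ^+ 2).
  by rewrite dset_mem ?/ballK/= -?xE -?yE//; lra.
rewrite dset_ball//=; last by rewrite -xE -yE ltW.
have N0 : 0 <= sqn x + y ^+ 2 by rewrite addr_ge0 ?sqn_ge0 ?sqr_ge0.
rewrite -xE -yE => /eqP; rewrite subr_eq => /eqP /(congr1 (fun z => z ^+ 2)).
rewrite sqr_sqrtr// xE yE (sqnorm_foot _ _ _ r) -/w => H.
have {}H : sqn t + f t ^+ 2 - r ^+ 2 = 2 * c * w * (r - alpha f t) by lra.
(* The left side of [H] is positive since [(t, f t)] lies outside the ball. *)
have ar : alpha f t < r.
  rewrite -subr_gt0 -(pmulr_rgt0 _ (_ : 0 < 2 * c * w)) -?H ?subr_gt0//.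
  by rewrite -mulrA mulr_gt0.
exists t => //; suff cE : Defs.coefp r f t = c by rewrite /xf /yf cE.
by rewrite /Defs.coefp H -/w; field; rewrite !gt_eqF ?subr_gt0.
Qed.

(** Meant for a fixed [q] while [p] runs over the equidistant set: this is the inequality that
    yields a first-order condition on that set. *)
Lemma equidistant_sqdist_ge r f p q : 0 < r -> admissible r f ->
  equidistant (ballK r) (epi f) p -> epi f q ->
  (Num.sqrt (sqn p.1 + p.2 ^+ 2) - r) ^+ 2 <= sqdist p q.
Proof.
move=> r0 adm /(equidistantP _ _ _ r0 adm)[t ar ->] fq.
have [[C1f _] [fconv _]] := adm; have c0 := coefp_gt0 _ _ _ adm ar.
apply: le_trans (foot_min f t _ q fconv C1f (ltW c0) fq).
rewrite sqdist_foot /= sqnorm_xf_yf// sqrtr_sqr ger0_norm ?addrK//.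
by rewrite addr_ge0 ?(ltW r0)// mulr_ge0 ?sqrtr_ge0 ?(ltW c0).
Qed.

(* The distances from (u, G u) to q := (t, f t) and to the ball coincide at
   u := xf r f t, and the former dominates everywhere; bounding the norm by
   2 |P| <= |P|^2 / |p| + |p| makes the first-order condition polynomial: it
   says that q and (r / |p|) p differ by a multiple of the normal of the graph. *)
Lemma hmap_xf r f G t : 0 < r -> admissible r f -> C1 G ->
  equidistant (ballK r) (epi f) = graph G -> alpha f t < r ->
  hmap r G (xf r f t) = t.
Proof.
move=> r0 adm C1G eqG ar; have c0 := coefp_gt0 _ _ _ adm ar.
have pG : graph G (xf r f t, yf r f t).
  by rewrite -eqG; apply/(equidistantP _ _ _ r0 adm); exists t.
have w0 := sqrt1sqn_gt0 (grad f t).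
have := sqdist_foot f t (Defs.coefp r f t); rewrite -/(xf r f t) -/(yf r f t).
have := sqnorm_xf_yf r f t ar.
set d := Defs.coefp r f t * _; have d0 : 0 < d by rewrite mulr_gt0.
rewrite /graph/= in pG; rewrite pG; set x := xf r f t => px; rewrite sqdistE/= px.
pose s := d + r; rewrite -/s in px *; have s0 : 0 < s by rewrite addr_gt0.
set Q := sqn t + f t ^+ 2 => dE.
have Qr : r ^+ 2 < Q by have [_ [_ [_]]] := adm; exact.
have := grad_graph_min G x t (r / s) (f t) (fun i => proj1 (C1G i) x).
set l := f t - r / s * G x; set g := grad G x => H.
have {}H : (r / s) *: x - t = l *: g.
  apply: H => u; have u0 : 0 <= sqn u + G u ^+ 2 by rewrite addr_ge0 ?sqn_ge0 ?sqr_ge0.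
  have /= : (Num.sqrt (sqn u + G u ^+ 2) - r) ^+ 2 <= sqdist (u, G u) (t, f t).
    apply: (equidistant_sqdist_ge r f (u, G u) (t, f t)) => //; last exact: lexx.
    by rewrite eqG.
  rewrite sqdistE/= px -/Q -{2}[sqn u + _]sqr_sqrtr//.
  rewrite -[in X in _ -> _ <= X](sqr_sqrtr u0).
  move: (Num.sqrt _) => S HS.
  have : 2 * S <= (S ^+ 2 + s ^+ 2) / s
    by rewrite ler_pdivlMr//; have := sqr_ge0 (S - s); lra.
  rewrite -(ler_pM2l r0).
  have -> : r * ((S ^+ 2 + s ^+ 2) / s) = r / s * S ^+ 2 + r * s.
    by field; rewrite gt_eqF.
  have -> : r / s * s ^+ 2 = r * s by field; rewrite gt_eqF.
  move: dE; rewrite (_ : d = s - r); last by rewrite /s; ring.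
  by lra.
have tE : t = (r / s) *: x - l *: g by rewrite -H opprB addrC subrK.
have fE : f t = r / s * G x + l by rewrite /l; ring.
pose B := dotp x g - G x; pose W := 1 + sqn g.
have W0 : 0 < W by rewrite ltr_wpDr ?sqn_ge0.
have sx : sqn x = s ^+ 2 - G x ^+ 2 by rewrite -px; ring.
have QE : Q = r ^+ 2 - 2 * l * (r / s) * B + l ^+ 2 * W.
  rewrite /Q fE tE sqnB !sqnZ dotpZl dotpZr sx /B /W; field; by rewrite gt_eqF.
have PE : dotp x t + G x * f t = r * s - l * B.
  rewrite fE tE dotpDr dotpNr !dotpZr -/(sqn x) sx /B; field; by rewrite gt_eqF.
(* [l = 0] would put the foot on the sphere of radius [r]. *)
have l0 : l != 0.
  apply/eqP => l0; move: Qr; rewrite QE l0.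
  by rewrite (_ : _ + _ = r ^+ 2) ?ltxx//; ring.
(* By [QE] and [PE] the distance equation [dE] is quadratic in [l] without constant term; its root 0
   is the radial point of the ball, and the other root is the foot. *)
have lE : l = - 2 * (1 - r / s) * B / W.
  apply: (mulfI l0); apply: (mulIf (lt0r_neq0 W0)).
  have -> : l * (- 2 * (1 - r / s) * B / W) * W = l * (- 2 * (1 - r / s) * B).
    by field; rewrite !gt_eqF.
  by move: dE; rewrite PE QE (_ : d = s - r); [lra | rewrite /s; ring].
rewrite /hmap px sqrtr_sqr gtr0_norm// -/g -/W [RHS]tE lE.
apply/rowP => i; rewrite !mxE /B; field; by rewrite !gt_eqF.
Qed.

End Equidistant.

(** * Equidistant functions and their parameterization *)

Theorem theorem12 (R : realType) (n : nat) (r : R) (G : 'rV[R]_n -> R)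
    (J : set 'rV[R]_n) (hinv : 'rV[R]_n -> 'rV[R]_n) :
  (1 <= n)%N -> 0 < r -> C2 G ->
  (forall x, 0 < sqn x + G x ^+ 2) ->
  open J -> J 0 ->
  (forall x, J (hmap r G x)) ->
  (forall x, hinv (hmap r G x) = x) ->
  (forall t, J t -> hmap r G (hinv t) = t) ->
  (forall x, \det (jac (hmap r G) x) != 0) ->
  (equidistant_function r G <->
   exists f, admissible r f /\ Df r f = J /\
     (forall t, J t -> xf r f t = hinv t /\ yf r f t = G (hinv t))).
Proof.
move=> _ r0 [C1G _] _ _ _ Jh hK Kh _; split=> -[f [adm]].
  move=> eqG; exists f; split => //.
  have hx t : Df r f t -> hmap r G (xf r f t) = t by exact: hmap_xf.
  have DJ : Df r f = J.
    apply/seteqP; split=> [t /hx <-//|t Jt].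
    (* The graph point over [hinv t] comes from some parameter [t'] in [Df r f]; applying [hmap r G]
       to its first coordinate gives both [t'] and [t]. *)
    have : graph G (hinv t, G (hinv t)) by [].
    rewrite -eqG => /(equidistantP _ _ _ r0 adm)[t' ar' [xE _]].
    by have := hx t' ar'; rewrite -xE Kh// => ->.
  split=> // t; rewrite -DJ => Dt.
  have xE : xf r f t = hinv t by rewrite -[in RHS](hx t Dt) hK.
  split=> //; rewrite -xE.
  have : equidistant (ballK r) (epi f) (xf r f t, yf r f t).
    by apply/(equidistantP _ _ _ r0 adm); exists t.
  by rewrite eqG.
move=> [DJ param]; exists f; split => //; apply/seteqP; split=> [p|[x y]].
  move=> /(equidistantP _ _ _ r0 adm)[t ar ->].
  have /param[-> ->] : J t by rewrite -DJ.
  by [].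
rewrite /graph/= => ->; apply/(equidistantP _ _ _ r0 adm).
(* The parameter of the graph point over [x] is [hmap r G x], which lies in [J]. *)
have [xE yE] := param _ (Jh x); exists (hmap r G x); last by rewrite xE yE hK.
by have := Jh x; rewrite -DJ.
Qed.
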